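(* Let $\mathcal S_{sb}$ be the set of semi-Baxter permutations, $\mathcal W_{sb}$ the set of two-dimensional walks in $\mathbb Z_{\ge0}^2$ started at $(0,0)$ with increments in $I_{sb}=\{(-i,1):i\ge0\}\cup\{(i,-i+1):i\ge1\}$, and $\mathcal C_{sb}=\mathrm{WC}_{sb}(\mathcal W_{sb})$. The diagram formed by the maps $$\mathrm{PW}:\mathcal S_{sb}\to\mathcal W_{sb},\qquad \mathrm{WC}_{sb}:\mathcal W_{sb}\to\mathcal C_{sb},\qquad \mathrm{CP}:\mathcal C_{sb}\to\mathcal S_{sb}$$ commutes, that is, $\mathrm{PW}^{-1}=\mathrm{CP}\circ\mathrm{WC}_{sb}$ on $\mathcal W_{sb}$.
   Context: Semi-Baxter permutations: a permutation $\sigma$ of $[n]=\{1,\dots,n\}$ is semi-Baxter if there are no indices $1\le i<j<k-1<n$ such that $\sigma(j+1)<\sigma(i)<\sigma(k)<\sigma(j)$. Active sites: for a permutation $\sigma$ of size $n$ and $m\in[n+1]$, $\sigma^{*m}$ is the permutation of size $n+1$ obtained by appending a new final value $m$ and shifting by $+1$ all the values $\ge m$. For $\sigma\in\mathcal S_{sb}$, $m$ is an active site of $\sigma$ if $\sigma^{*m}\in\mathcal S_{sb}$; $\mathrm{AS}(\sigma)$ is the set of active sites. The label of $\sigma\in\mathcal S_{sb}$ of size $n$ is $\big(\#\{m\in\mathrm{AS}(\sigma):m\le\sigma(n)\}-1,\ \#\{m\in\mathrm{AS}(\sigma):m>\sigma(n)\}-1\big)\in\mathbb Z_{\ge0}^2$.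 The map $\mathrm{PW}$: for $\sigma\in\mathcal S_{sb}$ of size $n$, $\mathrm{PW}(\sigma)=(W_1,\dots,W_n)$ where $W_m$ is the label of the permutation of size $m$ in the same relative order as $\sigma(1),\dots,\sigma(m)$. It is known that $\mathrm{PW}$ is a bijection from $\mathcal S_{sb}$ onto $\mathcal W_{sb}$, sending permutations of size $n$ to walks $(W_i)_{i\in[n]}$ with $n$ points. (This comes from the succession rule with root label $(0,0)$, and in which $(h,k)$ has children $(0,k+1),\dots,(h,k+1)$; $(h+k+1,0),(h+k,1),\dots,(h+1,k)$.) The map $\mathrm{WC}_{sb}$: for a walk $W=(X_t,Y_t)_{t\in I}$ with increments in $I_{sb}$ indexed by an interval $I\subseteq\mathbb Z$, $\mathrm{WC}_{sb}(W)=\{Z^{(t)}\}_{t\in I}$, where $Z^{(t)}_t=0$ and for $\ell\ge t$ with $\ell+1\in I$, writing $\Delta X=X_{\ell+1}-X_\ell$, $\Delta Y=Y_{\ell+1}-Y_\ell$, $$Z^{(t)}_{\ell+1}=\begin{cases}Z^{(t)}_\ell+\Delta Y,&\text{if }Z^{(t)}_\ell\ge0\text{ and }Z^{(t)}_\ell+\Delta Y>0,\\ Z^{(t)}_\ell-\Delta X,&\text{if }(Z^{(t)}_\ell\ge0\text{ and }Z^{(t)}_\ell+\Delta Y\le0)\text{ or }(Z^{(t)}_\ell<0\text{ and }Z^{(t)}_\ell-\Delta X<0),\\ 1,&\text{if }Z^{(t)}_\ell<0\text{ and }Z^{(t)}_\ell-\Delta X\ge0.\end{cases}$$ The map $\mathrm{CP}$: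 for such a family $Z=\{Z^{(t)}\}_{t\in[n]}$ define the relation $\le_Z$ on $[n]$ by $i\le_Z i$; for $i<j$: $i\le_Z j$ if $Z^{(i)}_j\le0$, and $j\le_Z i$ if $Z^{(i)}_j>0$. This is a total order, and $\mathrm{CP}(Z)$ is the unique permutation $\sigma$ of $[n]$ such that $\sigma(i)\le\sigma(j)\iff i\le_Z j$. (Here $Z^{(i)}_j\ne0$ for all $i<j$.) *)

(* Defs.v *)
From HB Require Import structures.
From mathcomp Require Import all_boot all_order all_algebra all_fingroup.

Set Implicit Arguments.
Unset Strict Implicit.
Unset Printing Implicit Defensive.

Import Order.TTheory GRing.Theory Num.Theory.

Local Open Scope ring_scope.

(* Permutations of [n] are elements of 'S_n and walks with n points are
   n-tuples over int * int, so indices, values and sites all start at 0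
   instead of 1. *)

Definition semibaxter (n : nat) (s : 'S_n) : bool :=
  ~~ [exists i : 'I_n, exists j : 'I_n, exists j1 : 'I_n, exists k : 'I_n,
        [&& (i < j)%N, j1 == j.+1 :> nat, (j1 < k)%N,
            (s j1 < s i)%N, (s i < s k)%N & (s k < s j)%N]].

(* lift_perm ord_max m s maps the last index to m, and any other index k to
   bump m (s k), that is, s k if s k < m and (s k).+1 if m <= s k. *)
Definition append_value (n : nat) (s : 'S_n) (m : 'I_n.+1) : 'S_n.+1 :=
  lift_perm ord_max m s.

Definition active_sites (n : nat) (s : 'S_n) : {set 'I_n.+1} :=
  [set m | semibaxter (append_value s m)].

Definition label (n : nat) (s : 'S_n.+1) : int * int :=
  (#|[set m in active_sites s | (m <= s ord_max)%N]|%:Z - 1,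
   #|[set m in active_sites s | (s ord_max < m)%N]|%:Z - 1).

(* The permutation s such that s i <= s j iff r i j. It exists exactly when r
   is a total order, and is then unique; otherwise the value is 1. *)
Definition perm_of_order (n : nat) (r : rel 'I_n) : 'S_n :=
  odflt 1%g [pick s : 'S_n | [forall i, forall j, (s i <= s j)%N == r i j]].

Lemma perm_of_orderE (n : nat) (r : rel 'I_n) :
  antisymmetric r -> transitive r -> total r ->
  forall i j, (perm_of_order r i <= perm_of_order r j)%N = r i j.
Proof.
move=> r_anti r_trans r_total.
pose A i := [set j | r j i].
have AS i j : (A i \subset A j) = r i j.
  apply/subsetP/idP => [/(_ i)|rij x]; rewrite !inE.
    by apply; case/orP: (r_total i i).
  by move/r_trans; apply.
have A_gt0 i : (0 < #|A i|)%N.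
  by apply/card_gt0P; exists i; rewrite inE; case/orP: (r_total i i).
have A_le i j : (#|A i| <= #|A j|)%N = r i j.
  apply/idP/idP => [le_ij|]; last by rewrite -AS => /subset_leq_card.
  case/orP: (r_total i j) => // rji.
  have /eqP eqA : A j == A i by rewrite eqEcard AS rji.
  by rewrite -AS eqA.
have rk_lt i : (#|A i|.-1 < n)%N.
  by rewrite prednK // -[leqRHS]card_ord max_card.
pose f i := Ordinal (rk_lt i).
have f_le i j : (f i <= f j)%N = r i j.
  by rewrite -A_le /= -ltnS !prednK.
have f_inj : injective f.
  move=> i j eq_f; apply: r_anti.
  by rewrite -!f_le eq_f leqnn.
rewrite /perm_of_order; case: pickP => [s /forallP s_r i j | /(_ (perm f_inj))].
  by have /forallP/(_ j)/eqP := s_r i.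
move/negP; case; apply/forallP => i; apply/forallP => j.
by rewrite !permE f_le.
Qed.

Lemma perm_of_order_uniq (n : nat) (r : rel 'I_n) (s : 'S_n) :
  (forall i j, (s i <= s j)%N = r i j) -> perm_of_order r = s.
Proof.
have mono (t : 'S_n) i : #|[set j | (t j <= t i)%N]| = (t i).+1.
  have -> : [set j | (t j <= t i)%N] = t @^-1: [set x : 'I_n | (x < (t i).+1)%N].
    by apply/setP => j; rewrite !inE ltnS.
  rewrite card_preimset; last exact: perm_inj.
  have lt_n : ((t i).+1 <= n)%N := ltn_ord (t i).
  have -> : [set x : 'I_n | (x < (t i).+1)%N] = [set widen_ord lt_n y | y in 'I_(t i).+1].
    apply/setP => x; rewrite inE; apply/idP/imsetP => [x_lt | [y _ ->]] /=.
      by exists (Ordinal x_lt) => //; apply: val_inj.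
    exact: ltn_ord y.
  rewrite card_imset ?card_ord // => x y /(congr1 val) /= eq_xy.
  exact: val_inj.
move=> s_r; rewrite /perm_of_order; case: pickP => [t /forallP t_r | /(_ s)].
  apply/permP => i; apply: val_inj; apply: succn_inj => /=.
  rewrite -!mono; apply: eq_card => j; rewrite !inE s_r.
  by have /forallP/(_ i)/eqP := t_r j.
by move/negP; case; apply/forallP => i; apply/forallP => j; rewrite s_r.
Qed.

(* The permutation of size m.+1 in the same relative order as
   s 0, ..., s m. *)
Definition prefix_perm (n : nat) (s : 'S_n) (m : 'I_n) : 'S_m.+1 :=
  perm_of_order (fun i j : 'I_m.+1 =>
    (s (widen_ord (ltn_ord m) i) <= s (widen_ord (ltn_ord m) j))%N).

Definition PW (n : nat) (s : 'S_n) : n.-tuple (int * int) :=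
  [tuple label (prefix_perm s m) | m < n].

Definition Isb (d : int * int) : Prop :=
  (exists2 i : int, 0 <= i & d = (- i, 1)) \/
  (exists2 i : int, 1 <= i & d = (i, - i + 1)).

Definition Wsb (n : nat) (W : n.-tuple (int * int)) : Prop :=
  [/\ nth 0 W 0 = 0,
      forall l, (l < n)%N -> 0 <= (nth 0 W l).1 /\ 0 <= (nth 0 W l).2
    & forall l, (l.+1 < n)%N -> Isb (nth 0 W l.+1 - nth 0 W l)].

Definition Zstep (z dX dY : int) : int :=
  if 0 <= z then
    if 0 < z + dY then z + dY else z - dX
  else
    if z - dX < 0 then z - dX else 1.

(* Zwalk W t d is the value at time t + d of the walk Z^(t) started at
   time t from 0. *)
Fixpoint Zwalk (W : nat -> int * int) (t d : nat) : int :=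
  if d is d'.+1 then
    let D := W (t + d').+1 - W (t + d')%N in
    Zstep (Zwalk W t d') D.1 D.2
  else 0.

(* A family {Z^(t)} is a function of t and then of the time l; only its values
   for t <= l are meaningful (WCsb puts 0 elsewhere and CP ignores them). *)
Definition WCsb (n : nat) (W : n.-tuple (int * int)) : 'I_n -> 'I_n -> int :=
  fun t l => Zwalk (nth 0 W) t (l - t).

Definition Csb (n : nat) (Z : 'I_n -> 'I_n -> int) : Prop :=
  exists2 W : n.-tuple (int * int), Wsb W & Z = WCsb W.

Definition leZ (n : nat) (Z : 'I_n -> 'I_n -> int) : rel 'I_n :=
  fun i j => [|| i == j, (i < j)%N && (Z i j <= 0) | (j < i)%N && (0 < Z j i)].

Definition CP (n : nat) (Z : 'I_n -> 'I_n -> int) : 'S_n :=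
  perm_of_order (leZ Z).

(* Main.v *)
(* Let F(x) be the number of active sites <= x of a semi-Baxter permutation s
   of last value v and largest site T.  Its label is (F(v) - 1, F(T) - F(v) - 1),
   and the sites v and v + 1 are always active.  Appending an active value m
   duplicates the site m, kills the sites q with m < q <= v and shifts the rest,
   which determines the new F.  Comparing with Zstep, one finds by induction on
   the size that the coalescent walk started at t currently has the value
   F(s t) - F(v), which is positive iff s t > v.  So CP (WC (PW s)) = s.
   Conversely, every admissible next point of a walk is the label of a child of
   s, by a discrete intermediate value argument on F, so PW is onto. *)
Require Import Defs.
From mathcomp Require Import all_boot all_order all_algebra all_fingroup.
From mathcomp Require Import zify.

Set Implicit Arguments.
Unset Strict Implicit.
Unset Printing Implicit Defensive.

Import Order.TTheory GRing.Theory Num.Theory.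

(** * Counting functions of sets of naturals *)

Section Rank.

Variable a : pred nat.

(** For [a := active s] this is the function F of the overview. *)
Definition rank (x : nat) : nat := \sum_(0 <= p < x.+1) a p.

Lemma rankS x : rank x.+1 = rank x + a x.+1.
Proof. by rewrite /rank big_nat_recr. Qed.

Lemma leq_rank x y : x <= y -> rank x <= rank y.
Proof.
move/subnK <-; elim: (y - x) => // d IHd.
by rewrite addSn rankS (leq_trans IHd) // leq_addr.
Qed.

Lemma ltn_rank x y : a y -> x < y -> rank x < rank y.
Proof.
case: y => // y ay; rewrite ltnS => /leq_rank le_xy.
by rewrite rankS ay addn1 ltnS.
Qed.

(** Discrete intermediate values: [rank] grows by steps of at most 1, and the first point at which
    it takes the value [v] satisfies [a]. *)
Lemma rank_onto v x : 0 < v <= rank x -> exists2 m, (m <= x) && a m & rank m = v.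
Proof.
elim: x => [|x IHx].
  rewrite /rank big_nat1; case a0: (a 0) => vP; last by lia.
  by exists 0; rewrite ?a0 // /rank big_nat1 a0; lia.
move=> /andP[v_gt0 v_le]; have [le_v|gt_v] := leqP v (rank x).
  have [|m /andP[le_mx am] <-] := IHx; first by rewrite v_gt0.
  by exists m; rewrite // am leqW.
exists x.+1; rewrite ?leqnn /=; move: v_le; rewrite rankS; last by lia.
by case: (a _) => //; lia.
Qed.

End Rank.

Lemma eq_rank (a b : pred nat) x :
  (forall p, p <= x -> a p = b p) -> rank a x = rank b x.
Proof. by move=> ab; apply: eq_big_nat => p /= /ab->. Qed.

(** * Active sites as a pattern condition *)

Section ActiveSite.

Variable n : nat.
Implicit Types (s : 'S_n) (p : nat).

Lemma semibaxterP s :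
  reflect (forall i j j1 k : 'I_n, i < j -> j1 = j.+1 :> nat -> j1 < k ->
             s j1 < s i -> s i < s k -> s k < s j -> False)
          (semibaxter s).
Proof.
apply: (iffP negP) => [sbs i j j1 k ij /eqP j1E jk h1 h2 h3|sbs].
  apply: sbs; apply/existsP; exists i; apply/existsP; exists j.
  by apply/existsP; exists j1; apply/existsP; exists k; rewrite ij j1E jk h1 h2.
move=> /existsP[i /existsP[j /existsP[j1 /existsP[k]]]].
by case/and5P=> ij /eqP j1E jk h1 /andP[]; apply: sbs ij j1E jk h1.
Qed.

(** The forbidden pattern with the appended value [p] in the role of [k]. The shift of the values
    that are at least [p] makes one inequality strict and the other weak. Taking [p] in [nat] lets
    the sites be counted by [rank]. *)
Definition active s p : bool :=
  ~~ [exists i : 'I_n, exists j : 'I_n, exists j1 : 'I_n,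
        [&& i < j, j1 == j.+1 :> nat, s j1 < s i, s i < p & p <= s j]].

Lemma activeP s p :
  reflect (forall i j j1 : 'I_n, i < j -> j1 = j.+1 :> nat ->
             s j1 < s i -> s i < p -> p <= s j -> False)
          (active s p).
Proof.
apply: (iffP negP) => [act_p i j j1 ij /eqP j1E h1 h2 h3|act_p].
  apply: act_p; apply/existsP; exists i; apply/existsP; exists j.
  by apply/existsP; exists j1; rewrite ij j1E h1 h2.
move=> /existsP[i /existsP[j /existsP[j1]]].
by case/and5P=> ij /eqP j1E h1; apply: act_p ij j1E h1.
Qed.

End ActiveSite.

Lemma append_last n (s : 'S_n) m : append_value s m ord_max = m.
Proof. exact: lift_perm_id. Qed.

Lemma append_lift n (s : 'S_n) m i :
  append_value s m (lift ord_max i) = bump m (s i) :> nat.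
Proof. by rewrite /append_value lift_perm_lift. Qed.

Lemma ord_lastP n (i : 'I_n.+1) :
  (i = ord_max) + {j : 'I_n | i = lift ord_max j}.
Proof. by case: (unliftP ord_max i) => [j|] ->; [right; exists j | left]. Qed.

Lemma bump_last n (i : 'I_n) : bump n i = i.
Proof. by rewrite /bump leqNgt ltn_ord. Qed.

(** In the pattern [i < j < j1 < k], the new last index can only play the role of [k]. Occurrences
    avoiding it are occurrences in [s]; the others are what [active] excludes. *)
Lemma semibaxter_append n (s : 'S_n) m :
  semibaxter (append_value s m) = semibaxter s && active s m.
Proof.
apply/semibaxterP/andP => [sbs|[/semibaxterP sbs /activeP act_m] i j j1 k].
  split; [apply/semibaxterP => i j j1 k|apply/activeP => i j j1].
    move=> ij jE jk h1 h2 h3.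
    apply: (sbs (lift ord_max i) (lift ord_max j) (lift ord_max j1) (lift ord_max k));
      rewrite ?append_lift /= ?bump_last //; rewrite /bump; lia.
  move=> ij jE h1 h2 h3.
  apply: (sbs (lift ord_max i) (lift ord_max j) (lift ord_max j1) ord_max);
    rewrite ?append_last ?append_lift /= ?bump_last //; rewrite /bump; lia.
case: (ord_lastP i) => [->|[{}i ->]]; first by have := ltn_ord j; rewrite /=; lia.
case: (ord_lastP j) => [->|[{}j ->]].
  by have := ltn_ord j1; rewrite /=; lia.
case: (ord_lastP j1) => [->|[{}j1 ->]].
  by have := ltn_ord k; rewrite /=; lia.
rewrite /= !bump_last => ij jE.
case: (ord_lastP k) => [->|[{}k ->]] /=.
  rewrite append_last !append_lift => _ h1 h2 h3.
  by apply: (act_m i j j1) => //; move: h1 h2 h3; rewrite /bump; lia.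
rewrite !append_lift bump_last => jk h1 h2 h3.
by apply: (sbs i j j1 k) => //; move: h1 h2 h3; rewrite /bump; lia.
Qed.

Lemma active_sitesE n (s : 'S_n) m :
  semibaxter s -> (m \in active_sites s) = active s m.
Proof. by move=> sbs; rewrite inE semibaxter_append sbs. Qed.

(** * Active sites and their counts after appending a value *)

Section AppendActive.

Variables (n : nat) (s : 'S_n.+1) (m : 'I_n.+2).

(** An obstruction that uses the new value [m] as the bottom of a descent needs a value strictly
    between [m] and [p], impossible when [p <= m]. *)
Lemma active_append_low p :
  p <= m -> active (append_value s m) p = active s p.
Proof.
move=> le_pm; apply/activeP/activeP => act_p i j j1.
  move=> ij jE h1 h2 h3.
  apply: (act_p (lift ord_max i) (lift ord_max j) (lift ord_max j1));
    rewrite ?append_lift /= ?bump_last //; rewrite /bump; lia.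
case: (ord_lastP i) => [->|[{}i ->]]; first by have := ltn_ord j; rewrite /=; lia.
case: (ord_lastP j) => [->|[{}j ->]].
  by have := ltn_ord j1; rewrite /=; lia.
rewrite /= !bump_last => ij.
case: (ord_lastP j1) => [->|[{}j1 ->]].
  by rewrite append_last !append_lift /bump; lia.
rewrite !append_lift /= bump_last => jE h1 h2 h3.
by apply: (act_p i j j1) => //; move: h1 h2 h3; rewrite /bump; lia.
Qed.

(* The sites strictly between the new value and the previous one are killed by
   the descent ending at the new value: the index where s takes the value m
   plays the role of i in the forbidden pattern. *)
Lemma active_append_high q :
  m <= q -> active (append_value s m) q.+1 = active s q && ~~ (m < q <= s ord_max).
Proof.
move=> le_mq; apply/activeP/andP => [act_q|[/activeP act_q Nq] i j j1].
  split.
    apply/activeP => i j j1 ij jE h1 h2 h3.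
    apply: (act_q (lift ord_max i) (lift ord_max j) (lift ord_max j1));
      rewrite ?append_lift /= ?bump_last //; rewrite /bump; lia.
  apply/negP => /andP[lt_mq le_q].
  have m_lt : m < n.+1 by have := ltn_ord (s ord_max); lia.
  pose i := (s^-1)%g (Ordinal m_lt).
  have si : s i = m :> nat by rewrite permKV.
  have i_lt : i < n.
    rewrite ltn_neqAle -ltnS ltn_ord andbT.
    apply/eqP => iE; have iM : i = ord_max by apply: val_inj.
    by move: si; rewrite iM; lia.
  apply: (act_q (lift ord_max i) (lift ord_max ord_max) ord_max);
    rewrite ?append_lift ?append_last /= ?bump_last //; rewrite /bump /= ?si; lia.
case: (ord_lastP i) => [->|[{}i ->]]; first by have := ltn_ord j; rewrite /=; lia.
case: (ord_lastP j) => [->|[{}j ->]].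
  by have := ltn_ord j1; rewrite /=; lia.
rewrite /= !bump_last => ij.
case: (ord_lastP j1) => [->|[{}j1 ->]].
  rewrite append_last !append_lift /= => - [jE].
  have -> : j = ord_max by apply: val_inj.
  by move: Nq; rewrite /bump; lia.
rewrite !append_lift /= bump_last => jE h1 h2 h3.
by apply: (act_q i j j1) => //; move: h1 h2 h3; rewrite /bump; lia.
Qed.

Local Notation a := (rank (active s)).
Local Notation a' := (rank (active (append_value s m))).

Lemma rank_append_low x : x <= m -> a' x = a x.
Proof.
by move=> le_xm; apply: eq_rank => p le_px; rewrite active_append_low //; lia.
Qed.

Hypothesis act_m : active s m.

(** In an ascent no site is killed, and the extra 1 counts the duplicate [m.+1] of the site [m]. *)
Lemma rank_append_up x : s ord_max < m -> m <= x -> a' x.+1 = (a x).+1.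
Proof.
move=> lt_m /subnK <-; elim: (x - m) => [|d IHd].
  by rewrite add0n rankS rank_append_low // active_append_high // ltnn act_m addn1.
rewrite addSn rankS IHd active_append_high ?rankS; last by lia.
have -> : (m < (d + m).+1 <= s ord_max) = false by lia.
by rewrite andbT.
Qed.

(** All sites [q] with [m < q <= s ord_max] are killed, so beyond [m] only its duplicate is
    counted. *)
Lemma rank_append_mid x : m <= x <= s ord_max -> a' x.+1 = (a m).+1.
Proof.
case/andP=> /subnK <-; elim: (x - m) => [|d IHd] le_x.
  by rewrite add0n rankS rank_append_low // active_append_high // ltnn act_m addn1.
by rewrite addSn rankS IHd ?active_append_high; lia.
Qed.

(** Past the killed sites the count has gained the duplicate and lost [a (s ord_max) - a m]; the
    additive form avoids truncated subtraction. *)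
Lemma rank_append_down x :
  m <= s ord_max <= x -> a' x.+1 + a (s ord_max) = (a m + a x).+1.
Proof.
case/andP=> le_m /subnK <-; elim: (x - _) => [|d IHd].
  by rewrite add0n rank_append_mid ?le_m //=.
rewrite addSn rankS [in RHS]rankS active_append_high; last by lia.
have -> : (m < (d + s ord_max).+1 <= s ord_max) = false by lia.
by rewrite andbT addnAC IHd; lia.
Qed.

End AppendActive.

(** * Sites that are always active, and the label in terms of [rank] *)

Lemma active_last n (s : 'S_n.+1) : semibaxter s -> active s (s ord_max).
Proof.
move/semibaxterP=> sbs; apply/activeP => i j j1 ij jE h1 h2 h3.
have jn : j1 < n.+1 := ltn_ord j1.
case: (eqVneq j1 ord_max) => [j1E|Nj1]; first by move: h1; rewrite j1E; lia.
case: (eqVneq (s ord_max) (s j)) => [/perm_inj jM|Ns].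
  by move: jE; rewrite -jM /=; lia.
apply: (sbs i j j1 ord_max) => //.
  by rewrite ltn_neqAle -ltnS jn andbT.
by rewrite ltn_neqAle h3 andbT.
Qed.

(** As for the site [s ord_max]: an obstruction [i], [j], [j1] cannot involve the last index, which
    would then complete it, as [k], to a forbidden pattern in [s]. *)
Lemma active_last_succ n (s : 'S_n.+1) :
  semibaxter s -> active s (s ord_max).+1.
Proof.
move/semibaxterP=> sbs; apply/activeP => i j j1 ij jE h1 h2 h3.
have jn : j1 < n.+1 := ltn_ord j1.
case: (eqVneq j1 ord_max) => [j1E|Nj1]; first by move: h1; rewrite j1E; lia.
case: (eqVneq (s ord_max) (s i)) => [/perm_inj iM|Ns].
  by move: jE; rewrite -iM in ij *; move: ij => /=; lia.
apply: (sbs i j j1 ord_max) => //.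
  by rewrite ltn_neqAle -ltnS jn andbT.
by rewrite ltn_neqAle eq_sym Ns.
Qed.

Lemma active0 n (s : 'S_n) : active s 0.
Proof. by apply/activeP => i j j1 _ _ _; rewrite ltn0. Qed.

Lemma card_active_sites n (s : 'S_n) (P : pred nat) : semibaxter s ->
  #|[set m in active_sites s | P m]| = \sum_(0 <= p < n.+1) (active s p && P p).
Proof.
move=> sbs; rewrite -sum1_card big_mkord big_mkcond; apply: eq_bigr => m _.
by rewrite inE active_sitesE //; case: andP.
Qed.

Local Open Scope ring_scope.

Lemma labelE n (s : 'S_n.+1) : semibaxter s ->
  label s = ((rank (active s) (s ord_max))%:Z - 1,
             (rank (active s) n.+1)%:Z - (rank (active s) (s ord_max))%:Z - 1).
Proof.
move=> sbs; rewrite /label.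
have lt_s := ltn_ord (s ord_max).
rewrite (card_active_sites (fun p => p <= s ord_max)%N sbs).
rewrite (card_active_sites (fun p => s ord_max < p)%N sbs).
have E1 : (\sum_(0 <= p < n.+2) (active s p && (p <= s ord_max)) =
          rank (active s) (s ord_max))%N.
  rewrite (@big_cat_nat _ _ _ (s ord_max).+1) //=; last exact: leqW.
  rewrite [X in (_ + X)%N]big_nat_cond [X in (_ + X)%N]big1 ?addn0; last first.
    by move=> p; rewrite andbT => /andP[h _]; rewrite leqNgt h andbF.
  by apply: eq_big_nat => p /=; rewrite ltnS => ->; rewrite andbT.
have E2 : (rank (active s) (s ord_max) +
           \sum_(0 <= p < n.+2) (active s p && (s ord_max < p)) =
          rank (active s) n.+1)%N.
  rewrite -E1 -big_split; apply: eq_big_nat => p _ /=.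
  by case: ltnP; case: (active s p).
by rewrite E1; congr (_, _); lia.
Qed.

(** * Removing the last value, and prefixes of walks *)

Lemma append_valueP n (s : 'S_n.+1) : exists s' m, s = append_value s' m.
Proof.
(* [unlift] closes the gap left by the last value. The default [i] is never reached, since [s] takes
   its last value only once. *)
pose f (i : 'I_n) := odflt i (unlift (s ord_max) (s (lift ord_max i))).
have liftf i : lift (s ord_max) (f i) = s (lift ord_max i).
  rewrite /f; case: unliftP => [j ->//|/perm_inj/eqP].
  by rewrite eq_sym (negPf (neq_lift _ _)).
have f_inj : injective f.
  by move=> i j /(congr1 (lift (s ord_max))); rewrite !liftf => /perm_inj/lift_inj.
exists (perm f_inj), (s ord_max); apply/permP => i.
case: (ord_lastP i) => [->|[{}i ->]]; first by rewrite append_last.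
by apply: val_inj; rewrite /= append_lift permE -liftf.
Qed.

Lemma append_le n (s : 'S_n) m i j :
  (append_value s m (lift ord_max i) <= append_value s m (lift ord_max j))%N =
  (s i <= s j)%N.
Proof. by rewrite !append_lift leq_bump2. Qed.

Lemma prefix_perm_last n (s : 'S_n.+1) : prefix_perm s ord_max = s.
Proof.
apply: perm_of_order_uniq => i j.
by congr (s _ <= s _)%N; apply: val_inj.
Qed.

Lemma perm_of_order_ext n (r r' : rel 'I_n) :
  (forall i j, r i j = r' i j) -> perm_of_order r = perm_of_order r'.
Proof.
move=> rr'; rewrite /perm_of_order; congr odflt; apply: eq_pick => s.
by apply: eq_forallb => i; apply: eq_forallb => j; rewrite rr'.
Qed.

Lemma nth_PW n (s : 'S_n) (l : 'I_n) : nth 0 (PW s) l = label (prefix_perm s l).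
Proof. by rewrite -tnth_nth tnth_mktuple. Qed.

Lemma nth_PW_last n (s : 'S_n.+1) : nth 0 (PW s) n = label s.
Proof. by rewrite (nth_PW s ord_max) prefix_perm_last. Qed.

Lemma nth_PW_append n (s : 'S_n) m l :
  (l < n)%N -> nth 0 (PW (append_value s m)) l = nth 0 (PW s) l.
Proof.
move=> l_lt; have l_ltS : (l < n.+1)%N by apply: leqW.
rewrite (nth_PW _ (Ordinal l_lt)) (nth_PW _ (Ordinal l_ltS)) /=.
congr label; apply: perm_of_order_ext => i j.
rewrite -(append_le s m); congr (append_value s m _ <= append_value s m _)%N;
  apply: val_inj; rewrite /= /bump.
  by have := ltn_ord i; lia.
by have := ltn_ord j; lia.
Qed.

Lemma eq_Zwalk (W W' : nat -> int * int) t d :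
  (forall l, (l <= t + d)%N -> W l = W' l) -> Zwalk W t d = Zwalk W' t d.
Proof.
elim: d => //= d IHd WW'; rewrite IHd ?WW' // => [||l le_l]; try by lia.
by apply: WW'; lia.
Qed.

(** * One step of the walk and of the coalescent walks *)

Section Step.

Variables (n : nat) (s : 'S_n.+1) (m : 'I_n.+2).
Hypotheses (sbs : semibaxter s) (act_m : active s m).

Local Notation a := (rank (active s)).
Local Notation s' := (append_value s m).

Lemma semibaxter_step : semibaxter s'.
Proof. by rewrite semibaxter_append sbs. Qed.

Lemma label_up : (s ord_max < m)%N ->
  label s' - label s =
    ((a m)%:Z - (a (s ord_max))%:Z, 1 - ((a m)%:Z - (a (s ord_max))%:Z)).
Proof.
move=> lt_m; rewrite !labelE ?semibaxter_step // append_last rank_append_low //.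
rewrite rank_append_up //; last by rewrite -ltnS.
by congr (_, _) => /=; lia.
Qed.

(** The killed sites all lie at or below the old last value, so the sites above the new one are the
    duplicate of [m] and the old upper sites, shifted: the second coordinate gains exactly 1. *)
Lemma label_down : (m <= s ord_max)%N ->
  label s' - label s = ((a m)%:Z - (a (s ord_max))%:Z, 1).
Proof.
move=> le_m; rewrite !labelE ?semibaxter_step // append_last rank_append_low //.
have := @rank_append_down _ _ _ act_m n.+1.
rewrite le_m ltnW // => /(_ isT) E.
by congr (_, _) => /=; lia.
Qed.

(** The branches of [Zstep] match the position of [s i]. In an ascent the test on [z + dY] decides
    whether [m <= s i]. In a descent, [s i < m] keeps the walk negative, [m <= s i < s ord_max]
    resets it to 1, and [s ord_max <= s i] adds 1. *)
Lemma Zstep_append i :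
  let D := label s' - label s in
  Zstep ((a (s i))%:Z - (a (s ord_max))%:Z) D.1 D.2 =
    (rank (active s') (s' (lift ord_max i)))%:Z
    - (rank (active s') (s' ord_max))%:Z.
Proof.
rewrite append_last append_lift (rank_append_low s (leqnn m)) /Zstep.
have [lt_m|le_m] := ltnP (s ord_max) m.
  rewrite label_up //= /bump; case: (leqP m (s i)) => [le_mi|lt_im].
    rewrite add1n rank_append_up //.
    have := leq_rank (active s) le_mi.
    have := ltn_rank act_m lt_m.
    by case: ifP; case: ifP; lia.
  rewrite add0n rank_append_low ?(ltnW lt_im) //.
  have := ltn_rank act_m lt_im.
  by case: ifP; case: ifP; try lia; case: ifP; lia.
rewrite label_down //= /bump.
have gE := leq_rank (active s) le_m.
case: (leqP m (s i)) => [le_mi|lt_im].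
  have hi := leq_rank (active s) le_mi.
  have [lt_i|ge_i] := ltnP (s i) (s ord_max).
    (* The last value is an active site, so the walk is strictly negative here. Only the duplicate
       of [m] survives between, whence the value 1. *)
    have := ltn_rank (active_last sbs) lt_i.
    rewrite add1n rank_append_mid ?le_mi ?(ltnW lt_i) //.
    by case: ifP; case: ifP; try lia; case: ifP; lia.
  have := leq_rank (active s) ge_i.
  have := @rank_append_down _ _ _ act_m (s i).
  rewrite le_m ge_i => /(_ isT).
  by rewrite add1n; case: ifP; case: ifP; lia.
rewrite add0n rank_append_low ?(ltnW lt_im) //.
have := ltn_rank act_m lt_im.
by case: ifP; case: ifP; try lia; case: ifP; lia.
Qed.

End Step.

(** * Coalescent walks recover the order of the permutation *)

Lemma rank_gt0 n (s : 'S_n) x : (0 < rank (active s) x)%N.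
Proof.
apply: leq_trans (leq_rank _ (leq0n x)).
by rewrite /rank big_nat1 active0.
Qed.

(** The active site just above the last value makes the rank jump there, so the sign of a rank
    difference detects the comparison of values. *)
Lemma rank_ltE n (s : 'S_n.+1) i : semibaxter s ->
  (rank (active s) (s ord_max) < rank (active s) (s i))%N = (s ord_max < s i)%N.
Proof.
move=> sbs; apply/idP/idP => [|lt_i].
  by rewrite !ltnNge; apply: contra; apply: leq_rank.
apply: leq_trans (leq_rank _ lt_i).
exact: ltn_rank (active_last_succ sbs) (ltnSn _).
Qed.

Lemma Zwalk_rank n (s : 'S_n.+1) (t : 'I_n.+1) : semibaxter s ->
  Zwalk (nth 0 (PW s)) t (n - t) =
    (rank (active s) (s t))%:Z - (rank (active s) (s ord_max))%:Z.
Proof.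
elim: n => [|n IHn] in s t *; first by rewrite (ord1 t) (ord1 ord_max) /= subrr.
have [s1 [m ->]] := append_valueP s.
rewrite semibaxter_append => /andP[sbs act_m].
case: (ord_lastP t) => [->|[{}t ->]]; first by rewrite subnn /= subrr.
rewrite -Zstep_append // -IHn // /= bump_last subSn /=; last by rewrite -ltnS.
rewrite subnKC; last by rewrite -ltnS.
rewrite nth_PW_last nth_PW_append // nth_PW_last; congr Zstep.
apply: eq_Zwalk => l; rewrite subnKC; last by rewrite -ltnS.
by move=> le_l; rewrite nth_PW_append.
Qed.

(** If [j] is last, this is [Zwalk_rank]. Otherwise dropping the last value changes neither the walk
    up to time [j] nor the relative order of [s i] and [s j]. *)
Lemma Zwalk_gt0 n (s : 'S_n) (i j : 'I_n) : semibaxter s -> (i <= j)%N ->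
  (0 < Zwalk (nth 0 (PW s)) i (j - i)) = (s j < s i)%N.
Proof.
elim: n => [|n IHn] in s i j *; first by case: i.
move=> sbs le_ij; case: (ord_lastP j) => [jE|[j' jE]].
  by rewrite jE /= Zwalk_rank // -rank_ltE //; lia.
case: (ord_lastP i) => [iE|[i' iE]].
  by move: le_ij; rewrite iE jE /= bump_last; have := ltn_ord j'; lia.
have [s1 [m sE]] := append_valueP s.
move: sbs le_ij; rewrite {}sE {}iE {}jE semibaxter_append => /andP[sbs _].
rewrite [in RHS]ltnNge append_le -ltnNge /= !bump_last => le_ij.
rewrite -IHn //; congr (0 < _); apply: eq_Zwalk => l; rewrite subnKC // => le_l.
by rewrite nth_PW_append //; have := ltn_ord j'; lia.
Qed.

Lemma leZ_PW n (s : 'S_n) : semibaxter s ->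
  forall i j, (s i <= s j)%N = leZ (WCsb (PW s)) i j.
Proof.
move=> sbs i j; rewrite /leZ /WCsb.
case: (ltngtP i j) => [lt_ij|lt_ji|/val_inj->]; last by rewrite eqxx leqnn.
  rewrite orbF (_ : (i == j) = false) /=; last by rewrite -val_eqE /=; lia.
  by rewrite leNgt Zwalk_gt0 ?(ltnW lt_ij) // leqNgt.
rewrite (_ : (i == j) = false) /=; last by rewrite -val_eqE /=; lia.
rewrite Zwalk_gt0 ?(ltnW lt_ji) // leq_eqVlt val_eqE.
by rewrite (inj_eq perm_inj) -val_eqE (gtn_eqF lt_ji).
Qed.

Lemma CP_PW n (s : 'S_n) : semibaxter s -> CP (WCsb (PW s)) = s.
Proof. by move=> sbs; apply: perm_of_order_uniq; apply: leZ_PW. Qed.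

(** * [PW] takes values in the walks and reaches all of them *)

Lemma label_ge0 n (s : 'S_n.+1) :
  semibaxter s -> 0 <= (label s).1 /\ 0 <= (label s).2.
Proof.
move=> sbs; rewrite labelE //=.
have := rank_gt0 s (s ord_max).
have := ltn_rank (active_last_succ sbs) (ltnSn _).
have := leq_rank (active s) (ltn_ord (s ord_max)).
by lia.
Qed.

Lemma label_ord1 (s : 'S_1) : semibaxter s /\ label s = 0.
Proof.
have sbs : semibaxter s by apply/semibaxterP => i j; rewrite (ord1 i) (ord1 j).
have act p : active s p by apply/activeP => i j; rewrite (ord1 i) (ord1 j).
split=> //; rewrite labelE // (ord1 (s _)) /rank !big_nat_recr // big_geq //=.
by rewrite !act.
Qed.

Lemma Isb_label n (s : 'S_n.+1) (m : 'I_n.+2) :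
  semibaxter s -> active s m -> Isb (label (append_value s m) - label s).
Proof.
move=> sbs act_m; have [lt_m|le_m] := ltnP (s ord_max) m.
  rewrite label_up //; right; have lt_a := ltn_rank act_m lt_m.
  exists ((rank (active s) m)%:Z - (rank (active s) (s ord_max))%:Z); first by lia.
  by congr (_, _); rewrite addrC.
rewrite label_down //; left; have := leq_rank (active s) le_m => le_a.
exists ((rank (active s) (s ord_max))%:Z - (rank (active s) m)%:Z); first by lia.
by rewrite opprB.
Qed.

Lemma Wsb_PW n (s : 'S_n) : (0 < n)%N -> semibaxter s -> Wsb (PW s).
Proof.
case: n => // n in s *; elim: n => [|n IHn] in s * => _ sbs.
  have E : nth 0 (PW s) 0 = 0 by rewrite nth_PW_last; case: (label_ord1 s).
  by split=> // -[|l] //; rewrite E.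
have [s1 [m sE]] := append_valueP s.
move: (sbs); rewrite {1}sE semibaxter_append => /andP[sbs1 act_m].
have [W0 Wge WI] := IHn s1 isT sbs1.
have PWE l : (l < n.+1)%N -> nth 0 (PW s) l = nth 0 (PW s1) l.
  by rewrite sE; apply: nth_PW_append.
split=> [|l|l]; first by rewrite PWE.
  rewrite ltnS leq_eqVlt => /orP[/eqP->|lt_l]; last by rewrite PWE //; apply: Wge.
  by rewrite nth_PW_last; apply: label_ge0.
rewrite !ltnS leq_eqVlt => /orP[/eqP->|lt_l]; last first.
  by rewrite !PWE ?ltnS ?(ltnW lt_l) //; apply: WI.
by rewrite nth_PW_last PWE // nth_PW_last sE; apply: Isb_label.
Qed.

(** The first coordinate of a child's label is the rank of its site minus 1, so [w.1] prescribes the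
    rank of [m], and [rank_onto] supplies an active site. Non-negativity of [w.1] (descent) or [w.2]
    (ascent) puts that rank in range. *)
Lemma label_child n (s : 'S_n.+1) (w : int * int) :
  semibaxter s -> 0 <= w.1 -> 0 <= w.2 -> Isb (w - label s) ->
  exists2 m : 'I_n.+2, active s m & label (append_value s m) = w.
Proof.
move=> sbs w1 w2 wI.
suff [m act_m mE] : exists2 m : 'I_n.+2, active s m &
    label (append_value s m) - label s = w - label s.
  by exists m => //; apply: (addIr (- label s)).
have aS := ltn_rank (active_last_succ sbs) (ltnSn _).
have aT := leq_rank (active s) (ltn_ord (s ord_max)).
have a0 := rank_gt0 s (s ord_max).
case: wI => -[i i_ge wE].
  have wi : `|w.1|%N.+1%:Z = (rank (active s) (s ord_max))%:Z - i.
    by move/(congr1 fst): wE; rewrite labelE //=; lia.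
  have [|x /andP[le_x act_x] xE] := @rank_onto (active s) `|w.1|%N.+1 (s ord_max).
    by lia.
  have x_lt : (x < n.+2)%N by have := ltn_ord (s ord_max); lia.
  exists (Ordinal x_lt) => //; rewrite label_down //= wE xE.
  by congr (_, _); lia.
have wi : `|w.1|%N.+1%:Z = (rank (active s) (s ord_max))%:Z + i.
  by move/(congr1 fst): wE; rewrite labelE //=; lia.
have [|x /andP[le_x act_x] xE] := @rank_onto (active s) `|w.1|%N.+1 n.+1.
  by move/(congr1 snd): wE; rewrite labelE //=; lia.
have x_lt : (x < n.+2)%N by lia.
exists (Ordinal x_lt) => //; rewrite label_up //= ?wE ?xE.
  by congr (_, _); lia.
(* The rank of [x] exceeds that of the last value by [i >= 1], so [x] lies above it. *)
rewrite ltnNge; apply/negP => /(leq_rank (active s)); lia.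
Qed.

(** With [W] a function on [nat], its shorter prefixes need no new object in the induction;
    [label_child] provides the last point. *)
Lemma PW_surj n (W : nat -> int * int) :
  W 0%N = 0 -> (forall l, (l <= n)%N -> 0 <= (W l).1 /\ 0 <= (W l).2) ->
  (forall l, (l < n)%N -> Isb (W l.+1 - W l)) ->
  exists2 s : 'S_n.+1, semibaxter s & forall l, (l <= n)%N -> nth 0 (PW s) l = W l.
Proof.
elim: n => [|n IHn] W0 Wge WI.
  exists 1%g => [|l]; first by case: (label_ord1 1%g).
  rewrite leqn0 => /eqP->; rewrite nth_PW_last W0.
  by case: (label_ord1 1%g).
have [//|l le_l|l lt_l|s sbs sE] := IHn; [by apply: Wge; lia | by apply: WI; lia |].
have labs : label s = W n by rewrite -nth_PW_last sE.
have [w1 w2] := Wge n.+1 (leqnn _).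
have [|m act_m mE] := label_child sbs w1 w2; first by rewrite labs; apply: WI.
exists (append_value s m) => [|l]; first by rewrite semibaxter_append sbs.
rewrite leq_eqVlt => /orP[/eqP->|lt_l]; first by rewrite nth_PW_last.
by rewrite nth_PW_append // sE.
Qed.

Lemma PW_onto n (W : n.-tuple (int * int)) : (0 < n)%N -> Wsb W ->
  exists2 s : 'S_n, semibaxter s & PW s = W.
Proof.
case: n W => // n W _ [W0 Wge WI].
have [l le_l|l lt_l|s sbs sE] := @PW_surj n (nth 0 W) W0; [exact: Wge | exact: WI |].
exists s => //; apply: eq_from_tnth => l.
by rewrite !(tnth_nth 0) sE // -ltnS.
Qed.

Theorem theorem5p7 (n : nat) (n_gt0 : (0 < n)%N) :
  [/\ forall s : 'S_n, semibaxter s -> Wsb (PW s),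
      forall Z : 'I_n -> 'I_n -> int, Csb Z ->
        (forall i j : 'I_n, (CP Z i <= CP Z j)%N = leZ Z i j) /\
        semibaxter (CP Z),
      forall s : 'S_n, semibaxter s -> CP (WCsb (PW s)) = s
    & forall W : n.-tuple (int * int), Wsb W -> PW (CP (WCsb W)) = W].
Proof.
split=> [s sbs|Z [W WW ->]|s sbs|W WW].
- exact: Wsb_PW.
(* Surjectivity turns any member of [Csb] into the family of some [PW s], where the order is already
   known to be that of [s]. *)
- have [s sbs <-] := PW_onto n_gt0 WW.
  by rewrite CP_PW //; split=> //; apply: leZ_PW.
- exact: CP_PW.
- by have [s sbs <-] := PW_onto n_gt0 WW; rewrite CP_PW.
Qed.
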